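(* Let $X$ be either of the curves $\mathcal{X}_\eta$ (with $F=L$) or $\mathcal{X}_0$ (with $F=K$) described in the context, let $S=F[\{z_{N,\mu}:(N,\mu)\in A\}]$ and let $I_X\subseteq S$ be the canonical ideal. Let $z_{N_1,\mu_1}z_{N'_1,\mu'_1}$ and $z_{N_2,\mu_2}z_{N'_2,\mu'_2}$ be monomials of degree $2$ in $S$ such that $\mathrm{mdeg}(z_{N_1,\mu_1}z_{N'_1,\mu'_1})=\mathrm{mdeg}(z_{N_2,\mu_2}z_{N'_2,\mu'_2})$. Then $$z_{N_1,\mu_1}z_{N'_1,\mu'_1}-z_{N_2,\mu_2}z_{N'_2,\mu'_2}\in I_X.$$
   Context: Setting. Let $k$ be an algebraically closed field of characteristic $p>0$, $W(k)$ its ring of Witt vectors, $\zeta$ a primitive $p$-th root of unity, $\lambda=\zeta-1$, $\mathfrak{m}$ the maximal ideal of $W(k)[\zeta]$. Let $m\ge 1$ be an integer not divisible by $p$, and write $m=pq-\ell$ with $1\le \ell\le p-1$. Put $R=W(k)[\zeta][[x_1,\dots,x_q]]$ if $\ell=1$ and $R=W(k)[\zeta][[x_1,\dots,x_{q-1}]]$ if $\ell\ne 1$, $L=\mathrm{Quot}(R)$, $K=\mathrm{Quot}(R/\mathfrak{m}R)$ (so $K=\mathrm{Quot}(k[[x_1,\dots,x_q]])$ or $\mathrm{Quot}(k[[x_1,\dots,x_{q-1}]])$), and $$a(x)=x^q+x_1x^{q-1}+\cdots+x_{q-1}x+x_q\ \ (\ell=1),\qquad a(x)=x^q+x_1x^{q-1}+\cdots+x_{q-1}x\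 \ (\ell\neq1).$$ $\mathcal{X}_\eta$ is the non-singular projective curve over $L$ with affine model $y^p=\lambda^px^\ell+a(x)^p$; $\mathcal{X}_0$ is the non-singular projective curve over $K$ with affine model $X^p-X=x^\ell/a(x)^p$. Index set: $A=\{(N,\mu)\in\mathbb{N}^2:\lfloor\mu\ell/p\rfloor\le N\le\mu q-2,\ 1\le\mu\le p-1\}$. Bases of holomorphic differentials: $f_{N,\mu}dx=x^Ny^{-\mu}dx$, $(N,\mu)\in A$, for $H^0(\mathcal{X}_\eta,\Omega_{\mathcal{X}_\eta})$; $f_{N,\mu}dx=\dfrac{x^Na(x)^{p-1-\mu}X^{p-1-\mu}}{a(x)^{p-1}}dx$, $(N,\mu)\in A$, for $H^0(\mathcal{X}_0,\Omega_{\mathcal{X}_0})$. Canonical ideal: $I_X$ is the kernel of the graded $F$-algebra homomorphism $\phi:S\to\bigoplus_{n\ge0}H^0(X,\Omega_{X/F}^{\otimes n})$ with $z_{N,\mu}\mapsto f_{N,\mu}dx$. Multidegree: $\mathrm{mdeg}(z_{N_1,\mu_1}\cdots z_{N_d,\mu_d})=(d,\sum N_i,\sum\mu_i)$. *)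

(* Defs.v *)
(* The classical axioms of boolp serve only to make power series over a domain
   an idomainType. *)
From HB Require Import structures.
From mathcomp Require Import all_boot all_order all_algebra.
From mathcomp Require Import boolp.
From mathcomp Require Import mpoly.

Set Implicit Arguments.
Unset Strict Implicit.
Unset Printing Implicit Defensive.

Import GRing.Theory.
Local Open Scope ring_scope.

(* D[[x_1,...,x_n]]: families of coefficients indexed by monomials. *)
Record mpseries (n : nat) (D : Type) := MPSeries { mpsc : 'X_{1..n} -> D }.

Lemma mpseriesP n D (f g : mpseries n D) : mpsc f =1 mpsc g -> f = g.
Proof. by case: f g => [f] [g] /= /funext ->. Qed.

HB.instance Definition _ n D := gen_eqMixin (mpseries n D).
HB.instance Definition _ n D := gen_choiceMixin (mpseries n D).

Section PowerSeries.
Variables (n : nat) (D : idomainType).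
Implicit Types (f g h : mpseries n D).

Definition mps_const (c : D) : mpseries n D :=
  MPSeries (fun m => if m == 0%MM then c else 0).
Definition mps_var (i : 'I_n) : mpseries n D :=
  MPSeries (fun m => (m == U_(i)%MM)%:R).

Definition mps_zero : mpseries n D := MPSeries (fun _ => 0).
Definition mps_opp f : mpseries n D := MPSeries (fun m => - mpsc f m).
Definition mps_add f g : mpseries n D := MPSeries (fun m => mpsc f m + mpsc g m).
(* The bound on k.1 and k.2 only serves to make the index type finite: the
   sum is over all pairs (k.1, k.2) of monomials with product m. *)
Definition mps_mul f g : mpseries n D := MPSeries (fun m =>
  \sum_(k : 'X_{1..n < (mdeg m).+1, (mdeg m).+1} | m == (k.1 + k.2)%MM)
    mpsc f k.1 * mpsc g k.2).

Let mps_addA : associative mps_add.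
Proof. by move=> f g h; apply: mpseriesP => m /=; rewrite addrA. Qed.
Let mps_addC : commutative mps_add.
Proof. by move=> f g; apply: mpseriesP => m /=; rewrite addrC. Qed.
Let mps_add0 : left_id mps_zero mps_add.
Proof. by move=> f; apply: mpseriesP => m /=; rewrite add0r. Qed.
Let mps_addN : left_inverse mps_zero mps_opp mps_add.
Proof. by move=> f; apply: mpseriesP => m /=; rewrite addNr. Qed.

HB.instance Definition _ := GRing.isZmodule.Build (mpseries n D)
  mps_addA mps_addC mps_add0 mps_addN.

Definition mps_trunc d f : {mpoly D[n]} :=
  \sum_(m : 'X_{1..n < d}) mpsc f m *: 'X_[m].

Let mdeg_split d (m m1 m2 : 'X_{1..n}) : m = (m1 + m2)%MM ->
  (mdeg m < d)%N -> (mdeg m1 < d)%N * (mdeg m2 < d)%N.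
Proof.
move=> ->; rewrite mdegD => md.
by split; apply: leq_ltn_trans md; rewrite ?leq_addl ?leq_addr.
Qed.

Let truncE d f m : (mdeg m < d)%N -> (mps_trunc d f)@_m = mpsc f m.
Proof. exact: mcoeff_mpoly. Qed.

Lemma mps_mul_trunc d f g m : (mdeg m < d)%N ->
  mpsc (mps_mul f g) m = (mps_trunc d f * mps_trunc d g)@_m.
Proof.
move=> md; rewrite mcoeffM; apply: eq_bigr => k /eqP mE.
by have [d1 d2] := mdeg_split mE md; rewrite !truncE.
Qed.

Let mulm_ext (P P' Q Q' : {mpoly D[n]}) d m : (mdeg m < d)%N ->
  (forall m', (mdeg m' < d)%N -> P@_m' = P'@_m') ->
  (forall m', (mdeg m' < d)%N -> Q@_m' = Q'@_m') ->
  (P * Q)@_m = (P' * Q')@_m.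
Proof.
move=> md eP eQ; rewrite !mcoeffM; apply: eq_bigr => k /eqP mE.
by have [d1 d2] := mdeg_split mE md; rewrite eP ?eQ.
Qed.

Let trunc_mul d f g m : (mdeg m < d)%N ->
  (mps_trunc d (mps_mul f g))@_m = (mps_trunc d f * mps_trunc d g)@_m.
Proof. by move=> md; rewrite truncE // (mps_mul_trunc _ _ md). Qed.

Let mps_mulA : associative mps_mul.
Proof.
move=> f g h; apply: mpseriesP => m; have md := ltnSn (mdeg m).
rewrite !(mps_mul_trunc _ _ md).
rewrite (mulm_ext (P' := mps_trunc (mdeg m).+1 f) md _ (@trunc_mul _ g h)) //.
by rewrite mulrA; apply: (mulm_ext md) => // m' md'; rewrite trunc_mul.
Qed.
Let mps_mulC : commutative mps_mul.
Proof.
move=> f g; apply: mpseriesP => m.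
by rewrite !(mps_mul_trunc _ _ (ltnSn (mdeg m))) mulrC.
Qed.
Let mps_mul1 : left_id (mps_const 1) mps_mul.
Proof.
move=> f; apply: mpseriesP => m; have md := ltnSn (mdeg m).
rewrite (mps_mul_trunc _ _ md) -(truncE f md) -[in RHS](mul1r (mps_trunc _ f)).
apply: (mulm_ext md) => // m' md'; rewrite truncE // mcoeff1 /=.
by case: eqP.
Qed.
Let mps_mulDl : left_distributive mps_mul mps_add.
Proof.
move=> f g h; apply: mpseriesP => m /=; rewrite -big_split /=.
by apply: eq_bigr => k _; rewrite mulrDl.
Qed.
Let mps_one_neq0 : mps_const 1 != 0 :> mpseries n D.
Proof.
apply/eqP => /(congr1 (fun f => mpsc f 0%MM)) /=; rewrite eqxx => /eqP.
by rewrite oner_eq0.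
Qed.

HB.instance Definition _ := GRing.Zmodule_isComNzRing.Build (mpseries n D)
  mps_mulA mps_mulC mps_mul1 mps_mulDl mps_one_neq0.

Definition mps_unit : {pred mpseries n D} := fun f => `[< exists g, g * f = 1 >].
Definition mps_inv f : mpseries n D :=
  if pselect (exists g, g * f = 1) is left e then sval (cid e) else f.

Let mps_mulV : {in mps_unit, left_inverse 1 mps_inv *%R}.
Proof.
move=> f /asboolP fU; rewrite /mps_inv.
by case: pselect => // e; case: cid.
Qed.
Let mps_unitP (f g : mpseries n D) : g * f = 1 -> mps_unit f.
Proof. by move=> gf; apply/asboolP; exists g. Qed.
Let mps_inv_out : {in [predC mps_unit], mps_inv =1 id}.
Proof.
move=> f /negP fU; rewrite /mps_inv; case: pselect => // e.
by case: fU; apply/asboolP.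
Qed.

HB.instance Definition _ := GRing.ComNzRing_hasMulInverse.Build (mpseries n D)
  mps_mulV mps_unitP mps_inv_out.

Let mps_low f : f != 0 ->
  exists m, mpsc f m != 0 /\ forall m', (m' < m)%O -> mpsc f m' = 0.
Proof.
move=> f0; apply: contrapT => no.
case/eqP: f0; apply: mpseriesP => m /=.
elim/(@ltmwf n): m => m IH; apply/eqP/contraT => fm.
by case: no; exists m.
Qed.

Let mps_integral : GRing.integral_domain_axiom (mpseries n D).
Proof.
move=> f g fg0; apply/norP => -[/mps_low[mf [f0 fl]] /mps_low[mg [g0 gl]]].
have: mpsc (f * g) (mf + mg)%MM = 0 by rewrite fg0.
set m := (mf + mg)%MM.
have mfm : (mdeg mf < (mdeg m).+1)%N by rewrite ltnS mdegD leq_addr.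
have mgm : (mdeg mg < (mdeg m).+1)%N by rewrite ltnS mdegD leq_addl.
change (mpsc (mps_mul f g) m = 0 -> False); rewrite /mps_mul /=.
rewrite (bigD1 (BMultinom mfm, BMultinom mgm)) //= big1 ?addr0.
  by move=> /eqP; rewrite mulf_eq0 (negbTE f0) (negbTE g0).
move=> [k1 k2] /= /andP[/eqP mE ne].
case: (Order.TotalTheory.ltgtP (k1 : 'X_{1..n}) mf) => [lt|gt|eq1].
- by rewrite fl // mul0r.
- rewrite gl ?mulr0 //.
  rewrite Order.TotalTheory.ltNge; apply/negP => le.
  have := ltmc_le_add gt le.
  by rewrite -mE /m Order.POrderTheory.ltxx.
- have eq2 : (k2 : 'X_{1..n}) = mg.
    by apply: (@addmI n mf); rewrite -[LHS]/(mf + k2)%MM -{1}eq1 -mE.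
  case/eqP: ne; congr pair; exact: val_inj.
Qed.

HB.instance Definition _ := GRing.ComUnitRing_isIntegral.Build (mpseries n D)
  mps_integral.

End PowerSeries.

(* Quot(D[[x_1,...,x_n]]) *)
Definition psfrac (n : nat) (D : idomainType) : fieldType :=
  {fraction (mpseries n D)}.

(* n-th ghost component: \sum_(i <= n) p^i b_i^(p^(n-i)). *)
Definition ghost (p : nat) (B : pzRingType) (n : nat) (b : nat -> B) : B :=
  \sum_(i < n.+1) p%:R ^+ i * b i ^+ (p ^ (n - i)).

(* W is the ring of p-typical Witt vectors over k: its elements are the
   sequences w (a_0, a_1, ...) of elements of k, added and multiplied by the
   universal Witt polynomials, i.e. the unique integral polynomials turning
   each ghost component into a ring morphism. These polynomials are evaluated
   at a, a' by lifting a, a' to b, b' in a ring B without p-torsion, where the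
   Witt sum (product) c of b, b' is determined by its ghost components;
   B = int[X_0, Y_0, X_1, Y_1, ...] reaches every pair a, a'. *)
Definition is_witt_ring (p : nat) (k : comNzRingType) (W : comNzRingType) :=
  exists w : (nat -> k) -> W,
    bijective w /\
    forall (B : comNzRingType) (r : {rmorphism B -> k}),
      (forall b : B, p%:R * b = 0 -> b = 0) ->
      forall b b' c : nat -> B,
        ((forall n, ghost p n c = ghost p n b + ghost p n b') ->
           w (r \o c) = w (r \o b) + w (r \o b')) /\
        ((forall n, ghost p n c = ghost p n b * ghost p n b') ->
           w (r \o c) = w (r \o b) * w (r \o b')).

(* O = W[zeta], with zeta a primitive p-th root of unity in the domain O. *)
Definition is_cyclotomic_ext (p : nat) (W : comNzRingType) (O : idomainType)
    (iota : {rmorphism W -> O}) (zeta : O) :=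
  [/\ injective iota, p.-primitive_root zeta
    & forall u : O, exists f : {poly W}, u = (map_poly iota f).[zeta]].

(* The affine models: F(x) is {fraction {poly F}}; a curve is given by its
   monic equation over F(x). *)

Definition nbvars (q l : nat) : nat := if l == 1%N then q else q.-1.

(* a(x) over Quot(D[[x_1,...,x_n]]), n = nbvars q l; 'I_n starts at 0, so the
   variable of index i is x_(i+1). *)
Definition a_poly (q l : nat) (D : idomainType) :
    {poly psfrac (nbvars q l) D} :=
  'X^q + \sum_(i < nbvars q l)
    (tofrac (mps_var D i) : psfrac _ D) *: 'X^(q - i.+1).

(* Y^p - (lambda^p x^l + a(x)^p) *)
Definition kummer_eqn (F : fieldType) (p l : nat) (lambda : F) (a : {poly F}) :
    {poly {fraction {poly F}}} :=
  'X^p - (tofrac (lambda ^+ p *: 'X^l + a ^+ p))%:P.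

(* Y^p - Y - x^l / a(x)^p *)
Definition artin_schreier_eqn (F : fieldType) (p l : nat) (a : {poly F}) :
    {poly {fraction {poly F}}} :=
  'X^p - 'X - (tofrac 'X^l / tofrac (a ^+ p))%:P.

(* The non-singular projective curve over F with affine model G(x, Y) = 0 is
   the abstract non-singular curve of its function field F(x)[Y]/(G); its
   points are the valuation rings below. *)
Record curve (F : fieldType) (G : {poly {fraction {poly F}}}) := Curve {
  ffield :> fieldType;
  ff_incl : {rmorphism {fraction {poly F}} -> ffield};
  ff_y : ffield;
  ff_gen : forall u : ffield, exists P, u = (map_poly ff_incl P).[ff_y];
  ff_rel : forall P, (map_poly ff_incl P).[ff_y] = 0 <-> G %| P
}.

Section Curve.
Variables (F : fieldType) (G : {poly {fraction {poly F}}}) (X : curve G).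

Definition ff_const (c : F) : X := ff_incl X (tofrac c%:P).
Definition ff_poly (f : {poly F}) : X := ff_incl X (tofrac f).
Definition ff_x : X := ff_poly 'X.

(* Local rings O_{X,P}: valuation rings of the function field over F. The
   function field itself (the generic point) is included. *)
Definition local_ring (O : X -> Prop) : Prop :=
  [/\ forall c, O (ff_const c),
      forall u v, O u -> O v -> O (u - v),
      forall u v, O u -> O v -> O (u * v)
    & forall u, O u \/ O u^-1].

Definition derivation (M : lmodType X) (d : X -> M) : Prop :=
  [/\ forall c, d (ff_const c) = 0,
      forall u v, d (u + v) = d u + d v
    & forall u v, d (u * v) = u *: d v + v *: d u].

(* The graded algebra of meromorphic multidifferentials: (Omega, d) is the
   module of Kaehler differentials of the function field over F, and the pair
   (Omegas, tens) is its tensor algebra, the direct sum of all the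
   Omega^{(x) n}. Both are given by their universal property. *)
Record differentials := Differentials {
  Omega : lmodType X;
  dif : X -> Omega;
  dif_der : derivation dif;
  dif_univ : forall (M : lmodType X) (D : X -> M), derivation D ->
    exists h : {linear Omega -> M}, forall u, h (dif u) = D u;
  dif_uniq : forall (M : lmodType X) (h h' : {linear Omega -> M}),
    (forall u, h (dif u) = h' (dif u)) -> h =1 h';
  Omegas : algType X;
  tens : {linear Omega -> Omegas};
  tens_univ : forall (B : algType X) (g : {linear Omega -> B}),
    exists h : {lrmorphism Omegas -> B}, forall w, h (tens w) = g w;
  tens_uniq : forall (B : algType X) (h h' : {lrmorphism Omegas -> B}),
    (forall w, h (tens w) = h' (tens w)) -> h =1 h'
}.

Variable T : differentials.

(* H^0(X, Omega_{X/F}^{(x) n}): multidifferentials of degree n which at every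
   P are in the O_{X,P}-span of the dg_1 (x) ... (x) dg_n with all g_j in
   O_{X,P}, that is, in the stalk of Omega_{X/F}^{(x) n} at P. *)
Definition H0 (n : nat) (w : Omegas T) : Prop :=
  forall O : X -> Prop, local_ring O ->
  exists (r : nat) (u : 'I_r -> X) (g : 'I_r -> 'I_n -> X),
    [/\ forall i, O (u i), forall i j, O (g i j)
      & w = \sum_(i < r) u i *: \prod_(j < n) tens T (dif T (g i j))].

End Curve.

(* (N, mu) \in A; N <= mu q - 2 is written N + 2 <= mu q, since mu q - 2 may
   be negative. *)
Definition inA (p q l N mu : nat) : bool :=
  [&& (mu * l %/ p <= N)%N, (N + 2 <= mu * q)%N, (1 <= mu)%N & (mu <= p.-1)%N].

Lemma inA_bound p q l N mu : inA p q l N mu -> (N < p * q)%N && (mu < p)%N.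
Proof.
case/and4P=> _ leN mu1 lemu; have mup : (mu < p)%N.
  by case: p lemu mu1 => [|p]; rewrite ?leqn0 ?ltnS //= => /eqP->.
rewrite mup andbT; apply: leq_trans (leq_mul (ltnW mup) (leqnn q)).
by apply: leq_trans leN; rewrite addn2.
Qed.

(* A as a finite type; by inA_bound no element is lost. *)
Definition Aidx (p q l : nat) : finType :=
  {c : 'I_(p * q) * 'I_p | inA p q l c.1 c.2}.

Section PolynomialRing.
Variables (p q l : nat).

Definition idxN (c : Aidx p q l) : nat := (val c).1.
Definition idxmu (c : Aidx p q l) : nat := (val c).2.

(* The exponent of the monomial z_{N,mu} of S = F[{z_{N,mu}}]. *)
Definition zmon (c : Aidx p q l) : 'X_{1.. #|Aidx p q l|} :=
  U_(enum_rank c)%MM.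

Definition zvar (F : fieldType) (c : Aidx p q l) : {mpoly F[#|Aidx p q l|]} :=
  'X_[zmon c].

Definition multidegree (m : 'X_{1.. #|Aidx p q l|}) : nat * nat * nat :=
  (mdeg m, (\sum_c m (enum_rank c) * idxN c)%N,
           (\sum_c m (enum_rank c) * idxmu c)%N).

(* phi is the graded F-algebra morphism from S to the direct sum of the
   H^0(X, Omega_{X/F}^{(x) n}) which sends z_{N,mu} to f_{N,mu} dx. *)
Definition canonical_map (F : fieldType) (G : {poly {fraction {poly F}}})
    (X : curve G) (T : differentials X) (f : nat -> nat -> X)
    (phi : {rmorphism {mpoly F[#|Aidx p q l|]} -> Omegas T}) : Prop :=
  [/\ forall (c : F) s, phi (c *: s) = ff_const X c *: phi s,
      forall n s, s \is n.-homog -> H0 n (phi s)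
    & forall c, phi (zvar F c) =
        tens T (f (idxN c) (idxmu c) *: dif T (ff_x X))].

Definition canonical_ideal (F : fieldType) (G : {poly {fraction {poly F}}})
    (X : curve G) (T : differentials X)
    (phi : {rmorphism {mpoly F[#|Aidx p q l|]} -> Omegas T})
    (s : {mpoly F[#|Aidx p q l|]}) : Prop := phi s = 0.

End PolynomialRing.

(* x^N y^(-mu) *)
Definition f_eta (F : fieldType) (G : {poly {fraction {poly F}}})
    (X : curve G) (N mu : nat) : X :=
  ff_x X ^+ N * ff_y X ^- mu.

(* x^N a(x)^(p-1-mu) X^(p-1-mu) / a(x)^(p-1) *)
Definition f_zero (p : nat) (F : fieldType) (a : {poly F})
    (G : {poly {fraction {poly F}}}) (X : curve G) (N mu : nat) : X :=
  ff_x X ^+ N * ff_poly X a ^+ (p.-1 - mu) * ff_y X ^+ (p.-1 - mu)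
    / ff_poly X a ^+ p.-1.

(* Main.v *)
Require Import Defs.
From HB Require Import structures.
From mathcomp Require Import all_boot all_order all_algebra.
From mathcomp Require Import mpoly.
Import GRing.Theory.
Local Open Scope ring_scope.

(** The algebra of multidifferentials is an algebra over the function field, so
    a product of two differentials f dx and g dx equals (f g) (dx (x) dx): the
    image of a degree-2 monomial under the canonical map depends only on the
    product of its two coefficient functions.  On both curves the coefficient
    f_{N,mu} is a monomial in a few fixed functions whose exponents are affine
    in (N, mu), hence a product f_{N,mu} f_{N',mu'} depends only on N + N' and
    mu + mu' (lemmas [f_eta_mul] and [f_zero_mul]).  These sums are what the
    multidegree of z_{N,mu} z_{N',mu'} records ([sum_zmonD]), so two monomials
    of equal multidegree have the same image ([mem_canonical_ideal2]).  *)

Set Implicit Arguments.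
Unset Strict Implicit.
Unset Printing Implicit Defensive.

Lemma sum_zmonD p q l (c c' : Aidx p q l) (w : Aidx p q l -> nat) :
  (\sum_e (zmon c + zmon c')%MM (enum_rank e) * w e = w c + w c')%N.
Proof.
have single d : (\sum_e zmon d (enum_rank e) * w e = w d)%N.
  rewrite (bigD1 d) //= big1 => [|e ne].
    by rewrite /zmon mnm1E eqxx mul1n addn0.
  by rewrite /zmon mnm1E (inj_eq enum_rank_inj) eq_sym (negbTE ne).
by under eq_bigr do rewrite mnmDE mulnDl; rewrite big_split /= !single.
Qed.

Lemma multidegree2_inj p q l (c1 c1' c2 c2' : Aidx p q l) :
  multidegree (zmon c1 + zmon c1')%MM =
    multidegree (zmon c2 + zmon c2')%MM ->
  (idxN c1 + idxN c1' = idxN c2 + idxN c2')%N /\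
  (idxmu c1 + idxmu c1' = idxmu c2 + idxmu c2')%N.
Proof. by case=> _; rewrite !sum_zmonD. Qed.

Lemma idxmu_le p q l (c : Aidx p q l) : (idxmu c <= p.-1)%N.
Proof. by case/and4P: (valP c). Qed.

Section CanonicalIdeal.
Variables (p q l : nat) (F : fieldType) (G : {poly {fraction {poly F}}}).
Variables (X : curve G).

(** Scalars move freely across the tensor product, so each monomial is sent
    to the product of its two coefficient functions times dx (x) dx. *)
Lemma mem_canonical_ideal2 (T : differentials X) (f : nat -> nat -> X)
    (phi : {rmorphism {mpoly F[#|Aidx p q l|]} -> Omegas T})
    (c1 c1' c2 c2' : Aidx p q l) :
  canonical_map f phi ->
  f (idxN c1) (idxmu c1) * f (idxN c1') (idxmu c1') =
    f (idxN c2) (idxmu c2) * f (idxN c2') (idxmu c2') ->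
  canonical_ideal phi (zvar F c1 * zvar F c1' - zvar F c2 * zvar F c2').
Proof.
case=> _ _ phiz eqf; rewrite /canonical_ideal rmorphB !rmorphM /= !phiz.
by rewrite !linearZ /= -!scalerAl -!scalerAr !scalerA eqf subrr.
Qed.

Lemma f_eta_mul N N' mu mu' :
  f_eta X N mu * f_eta X N' mu' = f_eta X (N + N') (mu + mu').
Proof. by rewrite /f_eta mulrACA -exprD -invfM -exprD. Qed.

(** The bounds on mu and mu' make the truncated exponents p - 1 - mu add up. *)
Lemma f_zero_mul (a : {poly F}) N N' mu mu' :
  (mu <= p.-1)%N -> (mu' <= p.-1)%N ->
  f_zero p a X N mu * f_zero p a X N' mu' =
    ff_x X ^+ (N + N') * ff_poly X a ^+ (p.-1 + p.-1 - (mu + mu'))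
      * ff_y X ^+ (p.-1 + p.-1 - (mu + mu')) / ff_poly X a ^+ (p.-1 + p.-1).
Proof.
move=> le le'; have -> : (p.-1 + p.-1 - (mu + mu') =
    (p.-1 - mu) + (p.-1 - mu'))%N by rewrite subnDA -addnBAC // -addnBA.
rewrite /f_zero !exprD invfM mulrACA; congr (_ * _).
by rewrite mulrACA; congr (_ * _); rewrite mulrACA.
Qed.

End CanonicalIdeal.

Theorem proposition7 (p m q l : nat)
  (k : closedFieldType) (hk : p \in [pchar k])
  (W : comNzRingType) (hW : is_witt_ring p k W)
  (O : idomainType) (iota : {rmorphism W -> O}) (zeta : O)
  (hO : is_cyclotomic_ext p iota zeta)
  (hm : (1 <= m)%N) (hpm : ~~ (p %| m)%N)
  (hl : (1 <= l <= p.-1)%N) (hmql : (m + l = p * q)%N) :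
  (* the curve X_eta over L = Quot(W(k)[zeta][[x_1,...]]) *)
  (let L := psfrac (nbvars q l) O in
   let lambda : L := tofrac (mps_const (nbvars q l) (zeta - 1)) in
   forall (X : curve (kummer_eqn p l lambda (a_poly q l O)))
     (T : differentials X)
     (phi : {rmorphism {mpoly L[#|Aidx p q l|]} -> Omegas T}),
   canonical_map (@f_eta _ _ X) phi ->
   forall c1 c1' c2 c2' : Aidx p q l,
     multidegree (zmon c1 + zmon c1')%MM = multidegree (zmon c2 + zmon c2')%MM ->
     canonical_ideal phi
       (zvar L c1 * zvar L c1' - zvar L c2 * zvar L c2'))
  /\
  (* the curve X_0 over K = Quot(k[[x_1,...]]) *)
  (let K := psfrac (nbvars q l) k in
   forall (X : curve (artin_schreier_eqn p l (a_poly q l k)))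
     (T : differentials X)
     (phi : {rmorphism {mpoly K[#|Aidx p q l|]} -> Omegas T}),
   canonical_map (@f_zero p _ (a_poly q l k) _ X) phi ->
   forall c1 c1' c2 c2' : Aidx p q l,
     multidegree (zmon c1 + zmon c1')%MM = multidegree (zmon c2 + zmon c2')%MM ->
     canonical_ideal phi
       (zvar K c1 * zvar K c1' - zvar K c2 * zvar K c2')).
Proof.
split=> [L lambda|K] X T phi phiP c1 c1' c2 c2' /multidegree2_inj[eqN eqmu];
  apply: mem_canonical_ideal2 phiP _.
- by rewrite !f_eta_mul eqN eqmu.
- by rewrite !f_zero_mul ?idxmu_le // eqN eqmu.
Qed.
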